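(* Let $N$ be a nonnegative integer and let $f:[0,1]\to\mathbb{R}$ be convex. Then for every $v\in[0,1]$, $$(1-v)f(0)+vf(1)\ \geq\ f(v)+\sum_{n=0}^{N-1}r_{n}(v)\sum_{k=1}^{2^{n}}\Delta_{f}(n,k)\,\chi_{\left(\frac{k-1}{2^{n}},\frac{k}{2^{n}}\right)}(v)$$ and $$(1-v)f(0)+vf(1)\ \leq\ f(0)+f(1)-f(1-v)-\sum_{n=0}^{N-1}r_{n}(v)\sum_{k=1}^{2^{n}}\Delta_{f}(n,2^{n}-k+1)\,\chi_{\left(\frac{k-1}{2^{n}},\frac{k}{2^{n}}\right)}(v).$$
   Context: The functions $r_n:[0,1]\to\mathbb{R}$ are defined recursively by $r_0(v)=\min\{v,1-v\}$ and $r_n(v)=\min\{2r_{n-1}(v),1-2r_{n-1}(v)\}$ for $n\ge 1$. For a function $f$ on $[0,1]$, $\Delta_f(n,k)=f\left(\frac{k-1}{2^n}\right)+f\left(\frac{k}{2^n}\right)-2f\left(\frac{2k-1}{2^{n+1}}\right)$. $\chi_I$ is the characteristic function of the interval $I$ ($1$ on $I$, $0$ off $I$). A sum $\sum_{n=0}^{N-1}$ is zero when $N=0$. *)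

(* Defs.v *)
From HB Require Import structures.
From mathcomp Require Import all_boot all_order all_algebra.
From mathcomp Require Import all_classical all_reals all_analysis.

Set Implicit Arguments.
Unset Strict Implicit.
Unset Printing Implicit Defensive.

Import Order.TTheory GRing.Theory Num.Theory.

Local Open Scope classical_set_scope.
Local Open Scope ring_scope.

Fixpoint rfun (R : realType) (n : nat) (v : R) : R :=
  match n with
  | 0%N => Num.min v (1 - v)
  | m.+1 => Num.min (2 * rfun m v) (1 - 2 * rfun m v)
  end.

(* [k - 1] and [2 k - 1] are computed in [R], without truncation at 0. *)
Definition Delta (R : realType) (f : R -> R) (n k : nat) : R :=
  f ((k%:R - 1) / 2 ^+ n) + f (k%:R / 2 ^+ n)
  - 2 * f ((2 * k%:R - 1) / 2 ^+ n.+1).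

Definition open_dyadic (R : realType) (n k : nat) : set R :=
  `](k%:R - 1) / 2 ^+ n, k%:R / 2 ^+ n[%classic.

(* Main.v *)
Require Import Defs.
From HB Require Import structures.
From mathcomp Require Import all_boot all_order all_algebra.
From mathcomp Require Import all_classical all_reals all_analysis.
From mathcomp Require Import ring lra zify.

(** The functions [rfun n] are iterated tent maps: over each dyadic cell, the
    closed interval from [j/2^n] to [(j+1)/2^n], the graph of [rfun n] is a
    single tooth, the distance from [2^n v] to the nearer of [j] and [j+1]
    ([rfun_cell]).  Hence [rfun n v * Delta f n j.+1] is exactly what is lost
    at [v] when the chord of [f] over the cell is replaced by the two chords
    over its halves ([chord_refine]).  Summing over [n < N], the losses
    telescope ([dyadic_sum_telescope]): the chord of [f] over [[0, 1]] minus
    the double sum is the piecewise linear interpolation of [f] at the dyadic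
    points of level [N], evaluated at [v].  Convexity puts that interpolation
    above [f v], which is the first inequality.

    The open cells leave out the dyadic points, where every characteristic
    function of the level vanishes; this is harmless because [rfun n] vanishes
    there too ([dyadic_sum_cell]).

    The second inequality is the first one for the reflection
    [u |-> f (1 - u)], whose chord over [[0, 1]] is
    [f 0 + f 1 - ((1 - v) * f 0 + v * f 1)] and whose coefficients are those of
    [f] read from right to left ([Delta_reflect]). *)

Set Implicit Arguments.
Unset Strict Implicit.
Unset Printing Implicit Defensive.

Import Order.TTheory GRing.Theory Num.Theory.

Local Open Scope classical_set_scope.
Local Open Scope ring_scope.

(** Cells are closed and numbered from 0, so that the cell [j] here is the
    closure of [open_dyadic n j.+1]; dyadic points lie in two cells. *)
Definition in_cell (R : realType) (n j : nat) (v : R) : Prop :=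
  (j < 2 ^ n)%N /\ j%:R <= 2 ^+ n * v <= j%:R + 1.

Lemma in_cell_parent (R : realType) n j (v : R) :
  in_cell n.+1 j v -> in_cell n j./2 v.
Proof.
move=> [ltj /andP[lej jle]]; split; first by move: ltj; rewrite expnS; lia.
move: lej jle; rewrite exprS -[in j%:R](odd_double_half j) natrD -mul2n natrM.
by case: (odd j) => /= h1 h2; apply/andP; split; lra.
Qed.

Lemma ex_cell (R : realType) n (v : R) :
  0 <= v <= 1 -> exists j, in_cell n j v.
Proof.
move=> /andP[v0 v1]; elim: n => [|n [i [lti /andP[lei ile]]]].
  by exists 0%N; split=> //; rewrite expr0; lra.
have [h|h] := leP (2 ^+ n.+1 * v) ((2 * i)%:R + 1).
  exists (2 * i)%N; split; first by rewrite expnS ltn_mul2l.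
  by move: h; rewrite exprS natrM => h; apply/andP; split; lra.
exists (2 * i).+1; split; first by rewrite expnS; lia.
by move: h; rewrite exprS -natr1 natrM => h; apply/andP; split; lra.
Qed.

(** Doubling [rfun n] and folding it at [1/2] turns the tooth over a cell into
    two teeth of the same height, one over each half. *)
Lemma rfun_cell (R : realType) n j (v : R) : in_cell n j v ->
  rfun n v = Num.min (2 ^+ n * v - j%:R) (j%:R + 1 - 2 ^+ n * v).
Proof.
elim: n j => [|n IHn] j cj /=.
  have [] := cj; rewrite expn0 ltnS leqn0 => /eqP -> _.
  by rewrite expr0 mul1r subr0 add0r.
rewrite (IHn _ (in_cell_parent cj)) exprS.
have [_ /andP[]] := cj.
rewrite exprS -[in j%:R](odd_double_half j) natrD -mul2n natrM.
set x := 2 ^+ n * v; rewrite -!mulrA -/x.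
case: (odd j) => /= h1 h2.
  rewrite (_ : Num.min (x - _) _ = j./2%:R + 1 - x).
    by rewrite minC; congr Num.min; ring.
  by apply/min_idPr; lra.
rewrite (_ : Num.min (x - _) _ = x - j./2%:R); first by congr Num.min; ring.
by apply/min_idPl; lra.
Qed.

(** At the ends of the cell no indicator is 1 and the sum is not [c j.+1], but
    there the factor [rfun n v] is 0. *)
Lemma dyadic_sum_cell (R : realType) n j (v : R) (c : nat -> R) :
  in_cell n j v ->
  rfun n v * (\sum_(1 <= k < (2 ^ n).+1) c k * \1_(open_dyadic n k) v)
  = rfun n v * c j.+1.
Proof.
move=> cj; have [->|r0] := eqVneq (rfun n v) 0; first by rewrite !mul0r.
have [ltj /andP[jx xj]] := cj.
have e0 : (0 : R) < 2 ^+ n by rewrite exprn_gt0.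
have /andP[jltx xltj] : j%:R < 2 ^+ n * v < j%:R + 1.
  move: r0; rewrite (rfun_cell cj) => r0.
  rewrite !lt_neqAle jx xj !andbT; apply/andP; split.
    by apply: contraNneq r0 => <-; rewrite subrr; apply/eqP/min_idPl; lra.
  by apply: contraNneq r0 => ->; rewrite subrr; apply/eqP/min_idPr; lra.
have in_open k : (v \in open_dyadic n k) = (k == j.+1).
  rewrite /open_dyadic mem_setE in_itv /= ltr_pdivrMr// ltr_pdivlMr//.
  rewrite (mulrC v); apply/andP/eqP => [[h1 h2]|->]; last by rewrite -natr1; lra.
  have : (k%:R : R) < j.+2%:R by rewrite -!natr1; lra.
  have : (j%:R : R) < k%:R by lra.
  by rewrite !ltr_nat; lia.
congr (_ * _); rewrite (bigD1_seq j.+1) ?iota_uniq//=; last first.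
  by rewrite mem_index_iota.
rewrite indicE in_open eqxx mulr1 big1 ?addr0// => k /negPf kj.
by rewrite indicE in_open kj mulr0.
Qed.

(** The value at [v] of the affine function that agrees with [f] at both ends
    of the cell [j]. *)
Definition chord (R : realType) (f : R -> R) (n j : nat) (v : R) : R :=
  (j%:R + 1 - 2 ^+ n * v) * f (j%:R / 2 ^+ n)
  + (2 ^+ n * v - j%:R) * f ((j%:R + 1) / 2 ^+ n).

(** Both sides are affine on each half of the parent cell, and they agree at
    the ends of the parent and at its midpoint, where [rfun n] is [1/2] and
    the left side is half the second difference [Delta]. *)
Lemma chord_refine (R : realType) (f : R -> R) n j (v : R) :
  in_cell n.+1 j v ->
  chord f n j./2 v - chord f n.+1 j v = rfun n v * Delta f n j./2.+1.
Proof.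
move=> cj; rewrite (rfun_cell (in_cell_parent cj)).
have [_ /andP[]] := cj.
rewrite /chord /Delta -[in j%:R](odd_double_half j) natrD -mul2n natrM -(natr1 j./2).
have e0 : (2 : R) ^+ n != 0 by rewrite expf_neq0.
set i : R := j./2%:R; rewrite exprS addrK -!mulrA; set x := 2 ^+ n * v.
(* the midpoint of the parent cell is an end of the cell j *)
have -> : (2 * (i + 1) - 1) / (2 * 2 ^+ n) = (2 * i + 1) / (2 * 2 ^+ n).
  by congr (_ / _); ring.
case: (odd j) => /= h1 h2.
  have -> : (1 + 2 * i + 1) / (2 * 2 ^+ n) = (i + 1) / 2 ^+ n by field.
  rewrite (addrC 1 (2 * i)) (_ : Num.min (x - i) _ = i + 1 - x); first by ring.
  by apply/min_idPr; lra.
have -> : (0 + 2 * i) / (2 * 2 ^+ n) = i / 2 ^+ n by field.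
rewrite add0r (_ : Num.min (x - i) _ = x - i); first by ring.
by apply/min_idPl; lra.
Qed.

Lemma dyadic_sum_telescope (R : realType) (f : R -> R) N j (v : R) :
  in_cell N j v ->
  \sum_(0 <= n < N) rfun n v *
    (\sum_(1 <= k < (2 ^ n).+1) Delta f n k * \1_(open_dyadic n k) v)
  = (1 - v) * f 0 + v * f 1 - chord f N j v.
Proof.
elim: N j => [|N IHN] j cj.
  have [] := cj; rewrite expn0 ltnS leqn0 => /eqP -> _.
  by rewrite big_nil /chord expr0 !divr1 !add0r subr0 mul1r subrr.
have ci := in_cell_parent cj.
rewrite big_nat_recr//= (IHN _ ci) (dyadic_sum_cell _ ci) -(chord_refine _ cj).
by ring.
Qed.

Lemma convex_function_le (R : realType) (f : R -> R) (t a b : R) :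
  convex_function (`[0, 1]%classic : set R^o) f ->
  0 <= t <= 1 -> 0 <= a <= 1 -> 0 <= b <= 1 ->
  f (t * a + (1 - t) * b) <= t * f a + (1 - t) * f b.
Proof.
move=> cf /andP[t0 t1] a01 b01.
have := cf (Itv01 t0 t1) a b; rewrite !inE /= !in_itv /= a01 b01.
by move=> /(_ isT isT).
Qed.

Lemma convex_le_chord (R : realType) (f : R -> R) n j (v : R) :
  convex_function (`[0, 1]%classic : set R^o) f ->
  in_cell n j v -> f v <= chord f n j v.
Proof.
move=> cf [ltj /andP[jx xj]].
have e0 : (0 : R) < 2 ^+ n by rewrite exprn_gt0.
have j0 : (0 : R) <= j%:R by [].
have j1 : (j%:R : R) + 1 <= 2 ^+ n by rewrite natr1 -natrX ler_nat.
have H a : 0 <= a -> a <= (2 : R) ^+ n -> 0 <= a / 2 ^+ n <= 1.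
  by move=> a0 a1; rewrite ler_pdivlMr// ler_pdivrMr// mul0r mul1r a0.
have t01 : 0 <= j%:R + 1 - 2 ^+ n * v <= 1 by lra.
have := convex_function_le cf t01
  (H j%:R ltac:(lra) ltac:(lra)) (H (j%:R + 1) ltac:(lra) ltac:(lra)).
rewrite /chord (_ : 1 - (_ - _) = 2 ^+ n * v - j%:R); last by ring.
suff -> : (j%:R + 1 - 2 ^+ n * v) * (j%:R / 2 ^+ n)
    + (2 ^+ n * v - j%:R) * ((j%:R + 1) / 2 ^+ n) = v by [].
by field; rewrite gt_eqF.
Qed.

Lemma convex_dyadic_sum_le (R : realType) N (f : R -> R) (v : R) :
  convex_function (`[0, 1]%classic : set R^o) f -> 0 <= v <= 1 ->
  f v + \sum_(0 <= n < N) rfun n v *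
    (\sum_(1 <= k < (2 ^ n).+1) Delta f n k * \1_(open_dyadic n k) v)
  <= (1 - v) * f 0 + v * f 1.
Proof.
move=> cf /(ex_cell N)[j cj].
by rewrite (dyadic_sum_telescope f cj); have := convex_le_chord cf cj; lra.
Qed.

Lemma convex_reflect (R : realType) (f : R -> R) :
  convex_function (`[0, 1]%classic : set R^o) f ->
  convex_function (`[0, 1]%classic : set R^o) (fun u : R => f (1 - u)).
Proof.
move=> cf t a b; rewrite !inE /= !in_itv /= => a01 b01.
have t01 : 0 <= t%:num <= 1 by apply/andP.
have := @convex_function_le _ f t%:num (1 - a) (1 - b) cf t01.
move=> /(_ ltac:(lra) ltac:(lra)).
rewrite (_ : _ + _ * (1 - b) = 1 - (t%:num * a + (1 - t%:num) * b)) //.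
by ring.
Qed.

Lemma Delta_reflect (R : realType) (f : R -> R) n k : (k <= 2 ^ n)%N ->
  Delta f n (2 ^ n - k + 1) = Delta (fun u => f (1 - u)) n k.
Proof.
move=> kn; rewrite /Delta natrD natrB// natrX exprS.
have e0 : (2 : R) ^+ n != 0 by rewrite expf_neq0.
(* reflection reverses orientation, so the two end values are swapped *)
rewrite [X in X - _]addrC; congr (f _ + f _ - 2 * f _); field => //.
Qed.

Theorem theorem3 (R : realType) (N : nat) (f : R -> R)
    (convf : convex_function (`[0, 1]%classic : set R^o) f)
    (v : R) (v01 : v \in `[0, 1]) :
  (1 - v) * f 0 + v * f 1 >=
    f v + \sum_(0 <= n < N) rfun n v *
      \sum_(1 <= k < (2 ^ n).+1) Delta f n k * \1_(open_dyadic n k) v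
  /\
  (1 - v) * f 0 + v * f 1 <=
    f 0 + f 1 - f (1 - v) - \sum_(0 <= n < N) rfun n v *
      \sum_(1 <= k < (2 ^ n).+1)
        Delta f n (2 ^ n - k + 1) * \1_(open_dyadic n k) v.
Proof.
move: v01; rewrite in_itv /= => v01; split; first exact: convex_dyadic_sum_le.
have := convex_dyadic_sum_le N (convex_reflect convf) v01.
rewrite subr0 subrr.
under [X in _ + X <= _]eq_bigr => n _.
  under eq_big_nat => k /andP[_ kn] do rewrite -Delta_reflect//.
  over.
by lra.
Qed.
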